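(* Let $n\geq 4$. Among all simple strongly connected digraphs on $n$ vertices, $\overrightarrow{K}(n,n-2,1)$ is (up to isomorphism) the unique digraph which achieves the second maximum spectral radius, and this second maximum equals $\frac{n-2+\sqrt{n^2-4}}{2}$. (The maximum spectral radius, $n-1$, is achieved only by the complete digraph on $n$ vertices.)
   Context: Digraphs are finite and simple (no loops, no multiple arcs; opposite arcs allowed). The spectral radius $\rho(D)$ of a digraph $D$ is the spectral radius of its adjacency matrix $A(D)$. The complete digraph on $n$ vertices has all arcs $(i,j)$, $i\neq j$. $\overrightarrow{K}(n,n-2,1)$ is the digraph obtained from the complete digraph on $n$ vertices by deleting a single arc. *)

(* Defs.v *)
From mathcomp Require Import all_boot all_order all_algebra.
From mathcomp Require Import perm fingraph complex.
From mathcomp Require Import classical_sets reals.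

Set Implicit Arguments.
Unset Strict Implicit.
Unset Printing Implicit Defensive.

Import Order.TTheory GRing.Theory Num.Theory.

Local Open Scope classical_set_scope.
Local Open Scope complex_scope.
Local Open Scope ring_scope.

Record digraph (n : nat) : Type := Digraph {
  arc : rel 'I_n;
  arc_irrefl : irreflexive arc
}.

Definition digraph_iso (n : nat) (D D' : digraph n) : Prop :=
  exists s : 'S_n, forall i j : 'I_n, arc D' (s i) (s j) = arc D i j.

Definition strongly_connected (n : nat) (D : digraph n) : Prop :=
  forall i j : 'I_n, connect (arc D) i j.

Definition adjacency (R : realType) (n : nat) (D : digraph n) : 'M[R[i]]_n :=
  \matrix_(i, j) (arc D i j)%:R.

(* The norm of R[i] takes values in R[i] (on the real axis), hence the Re. *)
Definition spectral_radius (R : realType) (n : nat) (A : 'M[R[i]]_n) : R :=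
  sup [set complex.Re `|a| | a in [set a : R[i] | eigenvalue A a]].

Definition rho (R : realType) (n : nat) (D : digraph n) : R :=
  spectral_radius (adjacency R D).

Lemma complete_irrefl (n : nat) : irreflexive (fun i j : 'I_n => i != j).
Proof. by move=> i; rewrite eqxx. Qed.

Definition complete_digraph (n : nat) : digraph n :=
  Digraph (@complete_irrefl n).

Definition K_rel (n : nat) : rel 'I_n :=
  fun i j => (i != j) && ~~ ((i == 0 :> nat) && (j == 1 :> nat))%N.

Lemma K_irrefl (n : nat) : irreflexive (@K_rel n).
Proof. by move=> i; rewrite /K_rel eqxx. Qed.

(* K(n,n-2,1) with the arc (0,1) as the deleted one; all choices of the deleted
   arc are isomorphic.  For n < 2 there is no arc to delete. *)
Definition K_digraph (n : nat) : digraph n := Digraph (@K_irrefl n).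

Definition is_maximum (R : realType) (X : set R) (m : R) : Prop :=
  X m /\ ubound X m.

Definition is_second_maximum (R : realType) (X : set R) (r : R) : Prop :=
  exists2 m : R, is_maximum X m & is_maximum (X `\ m) r.

Definition sc_spectral_radii (R : realType) (n : nat) : set R :=
  [set r | exists2 D : digraph n, strongly_connected D & rho R D = r].

Arguments sc_spectral_radii R n : clear implicits.

(* Main.v *)
(** Let [A] be a nonnegative matrix and [y] a positive vector with [A y <= r y]
   entrywise.  Pairing [y] with the moduli [|v_i|] of a left eigenvector [v]
   shows that every eigenvalue satisfies [|a| <= r]; if moreover [A] is
   irreducible and [|a| = r], then [|v|] has no zero entry, and the pairing
   forces [A y = r y].

   A digraph which is not complete misses some arc [(p, q)], so its adjacency
   matrix is dominated by that of the complete digraph minus [(p, q)], whose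
   positive eigenvector is constant except at [p].  The two facts above, used
   with this vector, bound the spectral radius and show that a strongly connected
   digraph attaining the bound misses no other arc; with the all-ones vector
   they give the maximum. *)
Require Import Defs.
From mathcomp Require Import all_boot all_order all_algebra.
From mathcomp Require Import perm fingraph complex.
From mathcomp Require Import classical_sets reals.
From mathcomp Require Import ring lra.

Set Implicit Arguments.
Unset Strict Implicit.
Unset Printing Implicit Defensive.

Import Order.TTheory GRing.Theory Num.Theory.

Local Open Scope ring_scope.

(* [path.arc] would otherwise shadow the arcs of a digraph. *)
Local Notation arc := Defs.arc.

(** * Eigenvalues of a nonnegative matrix against a positive test vector *)

Section WeightedBound.

Variables (C : numFieldType) (n : nat) (A : 'M[C]_n) (y : 'I_n -> C) (r : C).
Hypothesis A_ge0 : forall i j, 0 <= A i j.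
Hypothesis y_gt0 : forall i, 0 < y i.
Hypothesis Ay_le : forall i, \sum_j A i j * y j <= r * y i.

Let weight_gt0 (v : 'rV[C]_n) : v != 0 -> 0 < \sum_j `|v 0 j| * y j.
Proof.
move=> /rV0Pn[k vk].
rewrite (bigD1 k) //= ltr_pwDl //; first by rewrite mulr_gt0 ?normr_gt0.
by apply: sumr_ge0 => j _; rewrite mulr_ge0 // ltW.
Qed.

Let norm_eigen_le {v : 'rV[C]_n} {a : C} (va : v *m A = a *: v) j :
  `|a| * `|v 0 j| <= \sum_i `|v 0 i| * A i j.
Proof.
rewrite -normrM; have := congr1 (fun u : 'rV[C]_n => u 0 j) va.
rewrite !mxE => <-; apply: le_trans (ler_norm_sum _ _ _) _.
by apply: ler_sum => i _; rewrite normrM (ger0_norm (A_ge0 _ _)).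
Qed.

Let exchange (v : 'rV[C]_n) :
  \sum_j (\sum_i `|v 0 i| * A i j) * y j = \sum_i `|v 0 i| * \sum_j A i j * y j.
Proof.
under eq_bigr do rewrite mulr_suml.
rewrite exchange_big /=; apply: eq_bigr => i _.
by rewrite mulr_sumr; apply: eq_bigr => j _; rewrite mulrA.
Qed.

Let pairing_lower {v : 'rV[C]_n} {a : C} (va : v *m A = a *: v) :
  `|a| * \sum_j `|v 0 j| * y j <= \sum_j (\sum_i `|v 0 i| * A i j) * y j.
Proof.
rewrite mulr_sumr; apply: ler_sum => j _.
by rewrite mulrA ler_wpM2r ?norm_eigen_le // ltW.
Qed.

Let pairing_upper (v : 'rV[C]_n) :
  \sum_i `|v 0 i| * \sum_j A i j * y j <= r * \sum_j `|v 0 j| * y j.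
Proof.
rewrite mulr_sumr; apply: ler_sum => i _.
by rewrite mulrCA ler_wpM2l.
Qed.

Lemma eigenvalue_norm_le (a : C) : eigenvalue A a -> `|a| <= r.
Proof.
move=> /eigenvalueP[v va v0].
rewrite -(ler_pM2r (weight_gt0 v0)); apply: le_trans (pairing_lower va) _.
by rewrite exchange pairing_upper.
Qed.

Lemma irreducible_eigenvalue_norm_eq (a : C) :
    (forall i j, connect (fun k l => A k l != 0) i j) ->
    eigenvalue A a -> `|a| = r ->
  forall i, \sum_j A i j * y j = r * y i.
Proof.
move=> A_irr /eigenvalueP[v va v0] ar.
have low := pairing_lower va; have up := pairing_upper v.
rewrite exchange ar in low.
have eqS := le_anti (introT andP (conj low up)).
(* The upper and lower bounds on the pairing now coincide. Since [y] is positive, every column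
   inequality is an equality: [|v|] is itself a left eigenvector for [|a|]. *)
have col j : `|a| * `|v 0 j| = \sum_i `|v 0 i| * A i j.
  have Z : \sum_j ((\sum_i `|v 0 i| * A i j) - `|a| * `|v 0 j|) * y j = 0.
    under eq_bigr do rewrite mulrBl.
    rewrite sumrB exchange -eqS ar mulr_sumr.
    by under [X in _ - X]eq_bigr do rewrite -mulrA; rewrite subrr.
  have N k : true -> 0 <= ((\sum_i `|v 0 i| * A i k) - `|a| * `|v 0 k|) * y k.
    by rewrite mulr_ge0 ?(ltW (y_gt0 k)) // subr_ge0 norm_eigen_le.
  have /eqP := psumr_eq0P N Z (i := j) isT.
  by rewrite mulf_eq0 (gt_eqF (y_gt0 j)) orbF subr_eq0 => /eqP.
(* If [v 0 j] vanished, column [j] would be a zero sum of nonnegative terms, so [v] would vanish at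
   every [i] with [A i j != 0]. Hence the support of [v] is closed under arcs, and irreducibility
   makes it everything. *)
have step i j : A i j != 0 -> v 0 i != 0 -> v 0 j != 0.
  move=> Aij; apply: contra_neq => vj; move: (col j).
  rewrite vj normr0 mulr0 => /esym/psumr_eq0P -/(_ _ i isT) H.
  apply/normr0_eq0/(mulIf Aij); rewrite mul0r; apply: H => k _.
  by rewrite mulr_ge0.
have [k vk] := rV0Pn _ v0.
have v_neq0 i : v 0 i != 0.
  have /connectP[s sp ->] := A_irr k i.
  by elim: s k vk sp => //= l s IH k vk /andP[/step kl]; apply/IH/kl.
(* The same argument on rows: the slacks are nonnegative and their weights [|v 0 i|] are now all
   positive. *)
have Z : \sum_i `|v 0 i| * (r * y i - \sum_j A i j * y j) = 0.
  under eq_bigr do rewrite mulrBr.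
  rewrite sumrB -eqS mulr_sumr.
  by under [X in X - _]eq_bigr do rewrite mulrCA; rewrite subrr.
have N l : true -> 0 <= `|v 0 l| * (r * y l - \sum_j A l j * y j).
  by rewrite mulr_ge0 // subr_ge0.
move=> i; have /eqP := psumr_eq0P N Z (i := i) isT.
by rewrite mulf_eq0 normr_eq0 (negPf (v_neq0 i)) subr_eq0 => /eqP.
Qed.

End WeightedBound.

(** * The supremum of the eigenvalue moduli is a maximum *)

Section SpectralRadius.

Variables (R : realType) (n : nat) (A : 'M[R[i]]_n).

(** The eigenvalues form the list [s] of roots of the characteristic polynomial, which splits over
    [R[i]]. Its degree [n] is positive, so [s] is nonempty and some entry has largest modulus. *)
Lemma spectral_radius_attained : (0 < n)%N ->
  exists2 a, eigenvalue A a
    & spectral_radius A = complex.Re `|a|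
      /\ forall b, eigenvalue A b -> complex.Re `|b| <= spectral_radius A.
Proof.
move=> n_gt0; have [s sE] := closed_field_poly_normal (char_poly A).
have eigE b : eigenvalue A b = (b \in s).
  rewrite eigenvalue_root_char sE rootZ ?root_prod_XsubC //.
  by rewrite lead_coef_eq0 -size_poly_gt0 size_char_poly.
have s_gt0 : (0 < size s)%N.
  have := size_char_poly A; rewrite sE size_scale ?size_prod_XsubC.
    by case=> ->.
  by rewrite lead_coef_eq0 -size_poly_gt0 size_char_poly.
pose f (k : 'I_(size s)) := complex.Re `|s`_k|.
pose m := [arg max_(k > Ordinal s_gt0) f k]%O.
have m_max b : eigenvalue A b -> complex.Re `|b| <= f m.
  rewrite eigE => /(nthP 0)[k ks <-]; rewrite /m.
  by case: arg_maxP => //= l _ /(_ (Ordinal ks) isT).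
have m_eig : eigenvalue A s`_m by rewrite eigE mem_nth.
suff E : spectral_radius A = f m by exists s`_m; rewrite ?E.
apply/le_anti/andP; split.
  by apply: ge_sup; [exists (f m), s`_m | move=> _ [b bA <-]; apply: m_max].
apply: ub_le_sup; last by exists s`_m.
by exists (f m) => _ [b bA <-]; apply: m_max.
Qed.

End SpectralRadius.

(** * Comparison with a larger digraph that has a positive eigenvector *)

Section Subdigraph.

Variables (R : realType) (n : nat) (D E : digraph n) (y : 'I_n -> R) (r : R).
Hypothesis n_gt0 : (0 < n)%N.
Hypothesis subDE : subrel (arc D) (arc E).
Hypothesis y_gt0 : forall i, 0 < y i.
Hypothesis Ey : forall i, \sum_j (arc E i j)%:R * y j = r * y i.

Let adj_ge0 i j : 0 <= adjacency R D i j.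
Proof. by rewrite mxE ler0n. Qed.

Let yC_gt0 i : 0 < (y i)%:C%C. Proof. by rewrite (ltcR 0). Qed.

Let adj_sum i :
  \sum_j adjacency R D i j * (y j)%:C%C = (\sum_j (arc D i j)%:R * y j)%:C%C.
Proof.
by rewrite rmorph_sum; apply: eq_bigr => j _; rewrite mxE rmorphM rmorph_nat.
Qed.

Let row_le i : \sum_j adjacency R D i j * (y j)%:C%C <= r%:C%C * (y i)%:C%C.
Proof.
rewrite adj_sum -rmorphM lecR -Ey; apply: ler_sum => j _.
rewrite ler_wpM2r ?(ltW (y_gt0 j)) // ler_nat.
by have := @subDE i j; case: (arc D i j) => // ->.
Qed.

Lemma rho_subdigraph_le : rho R D <= r.
Proof.
rewrite /rho.
have [a aD [-> _]] := spectral_radius_attained (adjacency R D) n_gt0.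
have := eigenvalue_norm_le adj_ge0 yC_gt0 row_le aD.
by rewrite lecE => /andP[].
Qed.

Lemma rho_subdigraph_eq : strongly_connected D -> rho R D = r ->
  arc D =2 arc E.
Proof.
move=> Dsc; rewrite /rho.
have [a aD [-> _] ar] := spectral_radius_attained (adjacency R D) n_gt0.
have a_norm : `|a| = r%:C%C by rewrite -ar RRe_real ?normr_real.
have irr i j : connect (fun k l => adjacency R D k l != 0) i j.
  rewrite (eq_connect (e' := arc D)) // => k l.
  by rewrite mxE pnatr_eq0; case: (arc D k l).
have Dy := irreducible_eigenvalue_norm_eq adj_ge0 yC_gt0 row_le irr aD a_norm.
move=> i j; apply/idP/idP => [/subDE //|Eij]; apply/negPn/negP => /negPf Dij.
have /eqP := Dy i; rewrite adj_sum -rmorphM eq_complex /= eqxx andbT -Ey.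
(* The missing arc [(i, j)] costs row [i] the positive amount [y j], and no other arc of [D] can
   make up for it. *)
apply/negP; rewrite lt_eqF //.
rewrite (bigD1 j) //= [ltRHS](bigD1 j) //= Dij Eij mul0r mul1r.
rewrite ltr_leD //; apply: ler_sum => k _.
rewrite ler_wpM2r ?(ltW (y_gt0 k)) // ler_nat.
by have := @subDE i k; case: (arc D i k) => // ->.
Qed.

End Subdigraph.

(** The sum runs over tails because [eigenvalue] refers to row vectors. No positivity of [x] is
    required: [r] is an eigenvalue, and [r <= |r|]. *)
Lemma eigenvector_le_rho (R : realType) (n : nat) (D : digraph n)
    (x : 'I_n -> R) (r : R) (k : 'I_n) :
    x k != 0 -> (forall j, \sum_i (arc D i j)%:R * x i = r * x j) ->
  r <= rho R D.
Proof.
move=> xk xD; have n_gt0 : (0 < n)%N by apply: leq_ltn_trans (ltn_ord k).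
have [_ _ [_ rho_max]] := spectral_radius_attained (adjacency R D) n_gt0.
have /rho_max : eigenvalue (adjacency R D) r%:C%C.
  apply/eigenvalueP; exists (\row_i (x i)%:C%C).
    apply/rowP => j; rewrite !mxE -rmorphM -xD rmorph_sum.
    by apply: eq_bigr => i _; rewrite !mxE rmorphM rmorph_nat mulrC.
  apply/rV0Pn; exists k; rewrite mxE eq_complex /=.
  by rewrite (negPf xk).
apply: le_trans; have := normc_ge_Re r%:C%C; rewrite lecE => /andP[_] /=.
exact/le_trans/ler_norm.
Qed.

(** * Complete digraphs and digraphs missing one arc *)

Lemma eq_arc_rho (R : realType) (n : nat) (D E : digraph n) :
  arc D =2 arc E -> rho R D = rho R E.
Proof.
by move=> DE; congr spectral_radius; apply/matrixP => i j; rewrite !mxE DE.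
Qed.

Lemma eq_arc_strongly_connected (n : nat) (D E : digraph n) :
  arc D =2 arc E -> strongly_connected E -> strongly_connected D.
Proof. by move=> DE Esc i j; rewrite (eq_connect DE). Qed.

Lemma complete_strongly_connected n : strongly_connected (complete_digraph n).
Proof.
by move=> i j; have [->|ij] := eqVneq i j; [exact: connect0|exact: connect1].
Qed.

Lemma iso_complete n (D : digraph n) :
  digraph_iso D (complete_digraph n) <-> arc D =2 arc (complete_digraph n).
Proof.
split=> [[s sD] i j|DE]; first by rewrite -sD /= (inj_eq perm_inj).
by exists 1%g => i j; rewrite !perm1 DE.
Qed.

(** The deleted arc is left arbitrary, so that the bounds apply directly to whichever arc is
    missing; relabelling it as [(0, 1)] is confined to [iso_K]. *)
Definition del_rel n (p q : 'I_n) : rel 'I_n :=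
  fun i j => (i != j) && ~~ ((i == p) && (j == q)).

Lemma del_irrefl n (p q : 'I_n) : irreflexive (del_rel p q).
Proof. by move=> i; rewrite /del_rel eqxx. Qed.

Definition del_digraph n (p q : 'I_n) : digraph n := Digraph (del_irrefl p q).

Lemma sub_complete n (D : digraph n) :
  subrel (arc D) (arc (complete_digraph n)).
Proof. by move=> i j; apply: contraTneq => ->; rewrite arc_irrefl. Qed.

Lemma sub_del n (D : digraph n) (p q : 'I_n) : ~~ arc D p q ->
  subrel (arc D) (arc (del_digraph p q)).
Proof.
move=> Dpq i j Dij; rewrite /= /del_rel (sub_complete Dij : i != j) /=.
by apply: contraNN Dpq => /andP[/eqP<- /eqP<-].
Qed.

Lemma complete_or_missing n (D : digraph n) :
  arc D =2 arc (complete_digraph n) \/ exists p q, p != q /\ ~~ arc D p q.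
Proof.
case: (boolP [forall p, forall q, (p != q) ==> arc D p q]).
  move=> /forallP H; left=> i j; apply/idP/idP => [/sub_complete //|].
  by move/forallP/(_ j)/implyP: (H i).
case/forallPn=> p /forallPn[q]; rewrite negb_imply => /andP[pq Dpq].
by right; exists p, q.
Qed.

Lemma del_strongly_connected n (p q : 'I_n) : (2 < n)%N -> p != q ->
  strongly_connected (del_digraph p q).
Proof.
move=> n_gt2 pq i j; have [->|ij] := eqVneq i j; first exact: connect0.
have [/andP[/eqP-> /eqP->]|nij] := boolP ((i == p) && (j == q)); last first.
  by apply: connect1; rewrite /= /del_rel ij.
(* The deleted arc is replaced by a path of length two through a third vertex. *)
have [k] : exists k, k \notin [set p; q].
  apply/existsP; rewrite -negb_forall; apply: contraL n_gt2 => /forallP H.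
  have /subset_leq_card : [set: 'I_n] \subset [set p; q].
    by apply/fintype.subsetP => k _; apply: H.
  by rewrite cardsT card_ord cards2 pq -leqNgt.
rewrite !inE negb_or => /andP[kp kq].
apply: (connect_trans (y := k)); apply: connect1; rewrite /= /del_rel.
  by rewrite eq_sym kp (negPf kq) andbF.
by rewrite kq (negPf kp).
Qed.

Lemma iso_K n (D : digraph n) : (1 < n)%N ->
  digraph_iso D (K_digraph n) <->
  exists p q : 'I_n, p != q /\ arc D =2 arc (del_digraph p q).
Proof.
move=> n_gt1; pose o0 : 'I_n := Ordinal (ltnW n_gt1); pose o1 := Ordinal n_gt1.
have KE i j : arc (K_digraph n) i j = del_rel o0 o1 i j by [].
split=> [[s sD]|[p [q [pq DE]]]].
  pose t := (s^-1)%g; have sK : cancel t s := permKV s.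
  exists (t o0), (t o1); rewrite (inj_eq perm_inj); split=> // i j.
  rewrite -sD KE /= /del_rel (inj_eq perm_inj).
  by rewrite -!(can2_eq (permK s) sK).
(* The first swap sends [p] to [0]; the second sends the image of [q] to [1] and fixes [0], which is
   neither that image nor [1]. *)
pose s := (tperm p o0 * tperm (tperm p o0 q) o1)%g.
have sp : s p = o0.
  rewrite permM tpermL tpermD //.
  by rewrite -[X in _ != X](tpermL p o0) (inj_eq perm_inj) eq_sym.
have sq : s q = o1 by rewrite permM tpermL.
exists s => i j; rewrite KE DE /= /del_rel (inj_eq perm_inj).
by rewrite -sp -sq !(inj_eq perm_inj).
Qed.

(** * Spectral radius of the complete digraph *)

Lemma sum_delta (R : pzRingType) n (i : 'I_n) (y : 'I_n -> R) :
  \sum_j (j == i)%:R * y j = y i.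
Proof.
rewrite (bigD1 i) //= eqxx mul1r big1 ?addr0 // => j /negPf->.
by rewrite mul0r.
Qed.

Lemma complete_eigenvector (R : pzRingType) n (i : 'I_n) :
  \sum_j (arc (complete_digraph n) i j)%:R * 1 = (n%:R - 1) * 1 :> R.
Proof.
transitivity (\sum_(j < n) (1 - (j == i)%:R * 1) : R).
  by apply: eq_bigr => j _ /=; rewrite eq_sym; case: eqP;
    rewrite !mulr1 ?subrr ?subr0.
by rewrite sumrB sum_delta sumr_const card_ord mulr1.
Qed.

Lemma rho_complete (R : realType) n : (0 < n)%N ->
  rho R (complete_digraph n) = n%:R - 1.
Proof.
move=> n_gt0; apply/le_anti/andP; split.
  by apply: (@rho_subdigraph_le _ _ _ (complete_digraph n) (fun=> 1)) => // i;
    exact: complete_eigenvector.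
apply: (eigenvector_le_rho (x := fun=> 1) (k := Ordinal n_gt0)) => [|j].
  exact: oner_neq0.
rewrite -[RHS](complete_eigenvector R j).
by apply: eq_bigr => i _; rewrite /= eq_sym.
Qed.

(** * Spectral radius after deleting one arc *)

Section DeletedArc.

Variables (R : realType) (n : nat).
Hypothesis n_gt2 : (2 < n)%N.

Let n_gt0 : (0 < n)%N. Proof. exact: leq_trans n_gt2. Qed.

Let r : R := (n%:R - 2 + Num.sqrt (n%:R ^+ 2 - 4)) / 2.

Let nR_ge3 : (3%:R : R) <= n%:R. Proof. by rewrite ler_nat. Qed.

Lemma rho2_gt0 : 0 < r.
Proof.
by rewrite divr_gt0 // ltr_pwDl ?sqrtr_ge0 //; have := nR_ge3; lra.
Qed.

Lemma rho2_eq : r ^+ 2 = (n%:R - 2) * (r + 1).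
Proof.
have : Num.sqrt (n%:R ^+ 2 - 4) ^+ 2 = n%:R ^+ 2 - 4 :> R.
  by rewrite sqr_sqrtr //; have := nR_ge3; nra.
by rewrite /r; set t := Num.sqrt _; lra.
Qed.

Lemma rho2_lt : r < n%:R - 1.
Proof. by have := rho2_eq; have := rho2_gt0; have := nR_ge3; nra. Qed.

(** The value at [p] is [r / (r + 1)]. Row [p] then asks for [n - 2 = r ^ 2 / (r + 1)], and any
    other row for [n - 1 - 1 / (r + 1) = r]; both amount to [rho2_eq]. *)
Let weight (p j : 'I_n) : R := 1 - (j == p)%:R * (r + 1)^-1.

Let weight_gt0 p j : 0 < weight p j.
Proof.
have r0 := rho2_gt0; rewrite subr_gt0; case: eqP => _; last by rewrite mul0r.
by rewrite mul1r invf_lt1; lra.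
Qed.

Lemma del_eigenvector (p q i : 'I_n) : p != q ->
  \sum_j (arc (del_digraph p q) i j)%:R * weight p j = r * weight p i.
Proof.
move=> pq; have r0 := rho2_gt0; have r1 : r + 1 != 0 by lra.
(* Row [i] is the all-ones row minus the diagonal entry and, when [i = p], minus the entry at [q];
   as [p != q], the two corrections never overlap. *)
transitivity (\sum_j (weight p j - (j == i)%:R * weight p j
                      - (i == p)%:R * ((j == q)%:R * weight p j))).
  apply: eq_bigr => j _; rewrite /= /del_rel eq_sym.
  have [->|ji] := eqVneq j i; have [ip|_] := eqVneq i p.
  - by rewrite ip (negPf pq) /=; ring.
  - by rewrite /=; ring.
  - by case: eqP => _ /=; ring.
  - by rewrite /=; ring.
rewrite 2!sumrB -mulr_sumr !sum_delta /weight sumrB sum_delta.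
rewrite sumr_const card_ord (eq_sym q) (negPf pq); case: eqP => _ /=; apply: (mulIf r1).
  by rewrite !mulrBl; field: rho2_eq.
by field: rho2_eq.
Qed.

Lemma rho_del (p q : 'I_n) : p != q -> rho R (del_digraph p q) = r.
Proof.
move=> pq; apply/le_anti/andP; split.
  apply: (@rho_subdigraph_le _ _ _ (del_digraph p q) (weight p)) => // i.
  exact: del_eigenvector.
(* A left eigenvector is needed here. Reversing all arcs turns the deleted arc into [(q, p)], so the
   weight is lowered at [q] instead of [p]. *)
apply: (eigenvector_le_rho (x := weight q) (k := p)) => [|j].
  exact/lt0r_neq0/weight_gt0.
rewrite -(@del_eigenvector q p) 1?eq_sym //; apply: eq_bigr => i _.
by rewrite /= /del_rel (eq_sym i j) (andbC (i == p)).
Qed.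

Lemma rho_missing_le (D : digraph n) (p q : 'I_n) : p != q -> ~~ arc D p q ->
  rho R D <= r.
Proof.
move=> pq /sub_del Dpq.
apply: (rho_subdigraph_le n_gt0 Dpq (weight_gt0 p)) => i.
exact: del_eigenvector.
Qed.

Lemma rho_missing_eq (D : digraph n) (p q : 'I_n) : p != q -> ~~ arc D p q ->
  strongly_connected D -> rho R D = r -> arc D =2 arc (del_digraph p q).
Proof.
move=> pq /sub_del Dpq.
apply: (rho_subdigraph_eq n_gt0 Dpq (weight_gt0 p)) => i.
exact: del_eigenvector.
Qed.

End DeletedArc.

Theorem theorem7p4 (R : realType) (n : nat) (hn : (4 <= n)%N) :
  let rho1 : R := n%:R - 1 in
  let rho2 : R := (n%:R - 2 + Num.sqrt (n%:R ^+ 2 - 4)) / 2 in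
  [/\ is_second_maximum (sc_spectral_radii R n) rho2,
      forall D : digraph n,
        (strongly_connected D /\ rho R D = rho2)
          <-> digraph_iso D (K_digraph n),
      is_maximum (sc_spectral_radii R n) rho1
    & forall D : digraph n,
        (strongly_connected D /\ rho R D = rho1)
          <-> digraph_iso D (complete_digraph n)].
Proof.
move=> rho1 rho2.
have n_gt2 : (2 < n)%N by apply: ltnW.
have n_gt1 : (1 < n)%N by apply: ltnW.
have n_gt0 : (0 < n)%N by apply: ltnW.
have lt21 : rho2 < rho1 by apply: rho2_lt.
have max1 : is_maximum (sc_spectral_radii R n) rho1.
  split=> [|_ [D Dsc <-]].
    exists (complete_digraph n); last exact: rho_complete.
    exact: complete_strongly_connected.
  have [/eq_arc_rho ->|[p [q [pq Dpq]]]] := complete_or_missing D.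
    by rewrite rho_complete.
  exact: le_trans (rho_missing_le R n_gt2 pq Dpq) (ltW lt21).
split=> // [|D|D].
(* A digraph whose radius is not [rho1] is not complete, hence misses an arc and is bounded by
   [rho2]. *)
- exists rho1 => //; split=> [|_ [[D Dsc <-] /eqP D1]].
    split; last by apply/eqP; rewrite lt_eqF.
    exists (del_digraph (Ordinal n_gt0) (Ordinal n_gt1)); last exact: rho_del.
    exact: del_strongly_connected.
  have [DE|[p [q [pq Dpq]]]] := complete_or_missing D.
    by rewrite (eq_arc_rho R DE) rho_complete ?eqxx in D1.
  exact: rho_missing_le Dpq.
- rewrite iso_K //; split=> [[Dsc D2]|[p [q [pq DE]]]].
    have [DE|[p [q [pq Dpq]]]] := complete_or_missing D.
      (* The strict inequality [rho2 < rho1] rules out the complete digraph. *)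
      by move: lt21; rewrite -D2 (eq_arc_rho R DE) rho_complete // ltxx.
    by exists p, q; split=> //; apply: (@rho_missing_eq R).
  split; last by rewrite (eq_arc_rho R DE) rho_del.
  exact/(eq_arc_strongly_connected DE)/del_strongly_connected.
- rewrite iso_complete; split=> [[Dsc D1]|DE].
    have [//|[p [q [pq Dpq]]]] := complete_or_missing D.
    have := rho_missing_le R n_gt2 pq Dpq.
    by rewrite D1 leNgt lt21.
  split; last by rewrite (eq_arc_rho R DE) rho_complete.
  exact/(eq_arc_strongly_connected DE)/complete_strongly_connected.
Qed.
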